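(* Let $A$ be a ring and let $M$ and $N$ be $A$-modules. Then $\mathrm{Ext}^1_A(M,N)$ can be identified with the set of isomorphism classes of $M$-cotorsors. Precisely, under the standard identification of $\mathrm{Ext}^1_A(M,N)$ with the set of isomorphism classes of extensions of $M$ by $N$, the map sending the class of an extension $(f:P\to M,\ \alpha_f:N\to\ker(f))$ to the isomorphism class of the $M$-cotorsor consisting of the homomorphism $f':N\to P$, $f'(n)=\alpha_f(n)$, together with $\tau_{f'}:P\to M\oplus P$, $\tau_{f'}(p)=(f(p),p)$, is a bijection from $\mathrm{Ext}^1_A(M,N)$ onto the set of isomorphism classes of objects of the category of $M$-cotorsors.
   Context: $A$ is a ring with multiplicative identity, not necessarily commutative; ''$A$-module'' means left $A$-module. $M$ and $N$ are fixed $A$-modules. An extension (of $M$ by $N$) is a surjective $A$-module homomorphism $f:P\to M$ together with an isomorphism of $A$-modules $\alpha_f:N\to\ker(f)$. A morphism of extensions from $f:P\to M$ to $g:Q\to M$ is an $A$-module homomorphism $h:P\to Q$ with $g\circ h=f$ and $h(\alpha_f(n))=\alpha_g(n)$ for all $n\in N$. Recall that $\mathrm{Ext}^1_A(M,N)$ is identified in the standard way with the set of isomorphism classes of extensions. The category of $A$-modules under $N$ has as objects the $A$-module homomorphisms $f:N\to P$, and as morphisms from $f:N\to P$ to $g:N\to Q$ the $A$-module homomorphisms $h:P\to Q$ with $h\circ f=g$. For an object $f:N\to P$ under $N$, $\beta_f:N\to M\oplus P$ denotes the object under $N$ given by $\beta_f(n)=(0,f(n))$, and $\pi_P:\beta_f\to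 f$ is the morphism $\pi_P(m,p)=p$. For objects $f:N\to P$, $g:N\to Q$ under $N$, put $P\amalg_N Q=\mathrm{coker}\big((f,-g):N\to P\oplus Q\big)$; the class of $(p,q)$ in it is again written $(p,q)$. An $M$-cotorsor is an injective $A$-module homomorphism $f:N\to P$ together with a morphism $\tau_f:f\to\beta_f$ of $A$-modules under $N$ (that is, an $A$-module homomorphism $\tau_f:P\to M\oplus P$ with $\tau_f\circ f=\beta_f$) such that (1) $\pi_P(\tau_f(p))=p$ for each $p\in P$; (2) for each $(m,p)\in M\oplus P$ there exists a unique $(p_1,p_2)\in P\amalg_N P$ such that $\tau_f(p_1)+(0,p_2)=(m,p)$ (the left side is independent of the representative of the class $(p_1,p_2)$). A morphism of $M$-cotorsors from $f:N\to P$ to $g:N\to Q$ is a morphism $h:f\to g$ of $A$-modules under $N$ such that $\tau_g\circ h=(\mathrm{id}_M\oplus h)\circ\tau_f$. *)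

(* Defs.v *)
From HB Require Import structures.
From mathcomp Require Import all_boot all_algebra.
From mathcomp Require Import boolp.

Set Implicit Arguments.
Unset Strict Implicit.
Unset Printing Implicit Defensive.

Import GRing.Theory.
Local Open Scope ring_scope.
Local Open Scope quotient_scope.

Section Kernel.
Context (A : pzRingType) (U V : lmodType A) (f : {linear U -> V}).

Definition ker_pred : {pred U} := fun u => f u == 0.

Lemma ker_submod_closed : submod_closed ker_pred.
Proof.
split; first by rewrite unfold_in linear0.
by move=> a u v; rewrite !unfold_in linearP => /eqP-> /eqP->; rewrite scaler0 addr0.
Qed.

HB.instance Definition _ :=
  GRing.isSubmodClosed.Build A U ker_pred ker_submod_closed.

Record ker : Type := Ker { ker_val :> U; _ : ker_val \in ker_pred }.

HB.instance Definition _ := [isSub for ker_val].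
HB.instance Definition _ := [Choice of ker by <:].
HB.instance Definition _ := [SubChoice_isSubZmodule of ker by <:].
HB.instance Definition _ := [SubZmodule_isSubLmodule of ker by <:].

End Kernel.

Section Cokernel.
Context (A : pzRingType) (U V : lmodType A) (f : {linear U -> V}).

(* A boolean predicate, by excluded middle, as [Quotient.quot] requires. *)
Definition im_pred : {pred V} := fun v => `[< exists u, f u = v >].

Lemma im_submod_closed : submod_closed im_pred.
Proof.
split; first by apply/asboolP; exists 0; rewrite linear0.
move=> a v w /asboolP[x <-] /asboolP[y <-].
by apply/asboolP; exists (a *: x + y); rewrite linearP.
Qed.

HB.instance Definition _ :=
  GRing.isSubmodClosed.Build A V im_pred im_submod_closed.

Definition coker : Type := Quotient.quot im_pred.

HB.instance Definition _ := GRing.Zmodule.on coker.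

Definition coker_class (v : V) : coker := \pi_(Quotient.quot im_pred) v.

Definition coker_repr (c : coker) : V := repr (c : Quotient.quot im_pred).

Lemma coker_reprK c : coker_class (coker_repr c) = c.
Proof. exact: reprK. Qed.

Lemma coker_classP v w :
  coker_class v = coker_class w <-> exists u, f u = v - w.
Proof.
rewrite /coker_class; split.
  by move=> /eqP; rewrite -Quotient.idealrBE => /asboolP.
by move=> H; apply/eqP; rewrite -Quotient.idealrBE; apply/asboolP.
Qed.

Lemma coker_classB : zmod_morphism coker_class.
Proof. exact: raddfB. Qed.

Definition coker_scale (a : A) (c : coker) : coker :=
  coker_class (a *: coker_repr c).

Lemma coker_classZ a v : coker_class (a *: v) = coker_scale a (coker_class v).
Proof.
apply/coker_classP.
have [u Hu] : exists u, f u = v - coker_repr (coker_class v).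
  by apply/coker_classP; rewrite coker_reprK.
by exists (a *: u); rewrite linearZ /= Hu scalerBr.
Qed.

Lemma coker_scaleA a b c :
  coker_scale a (coker_scale b c) = coker_scale (a * b) c.
Proof. by rewrite -[c]coker_reprK -!coker_classZ scalerA. Qed.

Lemma coker_scale1 : left_id 1 coker_scale.
Proof. by move=> c; rewrite -[c]coker_reprK -coker_classZ scale1r. Qed.

Lemma coker_classD v w : coker_class (v + w) = coker_class v + coker_class w.
Proof. exact: raddfD. Qed.

Lemma coker_scaleDr : right_distributive coker_scale +%R.
Proof.
move=> a c d; rewrite -[c]coker_reprK -[d]coker_reprK.
by rewrite -coker_classD -!coker_classZ -coker_classD scalerDr.
Qed.

Lemma coker_scaleDl c : {morph coker_scale^~ c : a b / a + b}.
Proof.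
move=> a b; rewrite -[c]coker_reprK.
by rewrite -!coker_classZ -coker_classD scalerDl.
Qed.

HB.instance Definition _ := GRing.Zmodule_isLmodule.Build A coker
  coker_scaleA coker_scale1 coker_scaleDr coker_scaleDl.

HB.instance Definition _ :=
  GRing.isZmodMorphism.Build V coker coker_class coker_classB.
HB.instance Definition _ :=
  GRing.isScalable.Build A V coker *:%R coker_class coker_classZ.

End Cokernel.

Section Pairing.
Context (A : pzRingType) (U V W : lmodType A).

Definition pairing (f : U -> V) (g : U -> W) (u : U) : V * W := (f u, g u).

Lemma pairing_is_linear (f : {linear U -> V}) (g : {linear U -> W}) :
  linear (pairing f g).
Proof. by move=> a u v; rewrite /pairing !linearP. Qed.

HB.instance Definition _ (f : {linear U -> V}) (g : {linear U -> W}) :=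
  GRing.isLinear.Build A U (V * W)%type *:%R (pairing f g)
    (pairing_is_linear f g).

End Pairing.

Section Extensions.
Context (A : pzRingType) (M N : lmodType A).

Record extension : Type := Extension {
  ext_mod : lmodType A;
  ext_map : {linear ext_mod -> M};
  ext_map_surj : forall m, exists p, ext_map p = m;
  ext_ker : {linear N -> ker ext_map};
  ext_ker_bij : bijective ext_ker
}.

Definition is_ext_hom (e1 e2 : extension)
    (h : {linear ext_mod e1 -> ext_mod e2}) : Prop :=
  (forall p, ext_map e2 (h p) = ext_map e1 p) /\
  (forall n, h (val (ext_ker e1 n)) = val (ext_ker e2 n)).

Definition ext_iso (e1 e2 : extension) : Prop :=
  exists (h : {linear ext_mod e1 -> ext_mod e2})
         (k : {linear ext_mod e2 -> ext_mod e1}),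
    [/\ is_ext_hom h, is_ext_hom k, cancel h k & cancel k h].

(* Ext^1 in Yoneda's form, as a mere set.  Isomorphism classes are subsets of the (large) type of objects, so that
   they can be compared by Leibniz equality. *)
Definition Ext1 : Type :=
  {C : extension -> Prop | exists e, C = ext_iso e}.

Definition Ext1_class (e : extension) : Ext1 :=
  exist _ (ext_iso e) (ex_intro _ e erefl).

End Extensions.

Section UnderCategory.
Context (A : pzRingType) (M N : lmodType A).

Record under : Type := Under {
  under_mod : lmodType A;
  under_map :> {linear N -> under_mod}
}.

Definition is_under_hom (f g : under)
    (h : {linear under_mod f -> under_mod g}) : Prop :=
  forall n, h (f n) = g n.

Definition beta (f : under) : under :=
  @Under (M * under_mod f)%type (pairing \0 f).

(* The coker of n |-> (f n, - g n). *)
Definition pushout (f g : under) : lmodType A := coker (pairing f (\- g)).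

Definition pushout_class (f g : under) (p : under_mod f) (q : under_mod g) :
  pushout f g := coker_class (pairing f (\- g)) (p, q).

End UnderCategory.

Section Cotorsors.
Context (A : pzRingType) (M N : lmodType A).

(* The data of an M-cotorsor; [is_cotorsor] below states its axioms. *)
Record precotorsor : Type := Precotorsor {
  ct_under :> under N;
  ct_tau : {linear under_mod ct_under -> under_mod (beta M ct_under)}
}.

(* (p1, p2) |-> tau p1 + (0, p2), evaluated at a chosen representative of the
   class; [ct_actE] shows that the choice does not matter. *)
Definition ct_act (c : precotorsor) (x : pushout c c) : M * under_mod c :=
  let r := coker_repr x in ct_tau c r.1 + (0, r.2).

Lemma ct_actE (c : precotorsor) (p1 p2 : under_mod c) :
  is_under_hom (ct_tau c) ->
  ct_act (pushout_class p1 p2) = ct_tau c p1 + (0, p2).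
Proof.
move=> tauN; rewrite /ct_act.
set r := coker_repr _.
have /coker_classP[n] : coker_class (pairing c (\- c)) r = pushout_class p1 p2.
  exact: coker_reprK.
case: r => r1 r2 [] /= E1 E2.
rewrite -[r1](subrK p1) -E1 -[r2](subrK p2) -E2 linearD tauN /=.
rewrite addrAC addrC; congr (_ + _).
by apply: injective_projections; rewrite /= ?addr0 // addrA subrr add0r.
Qed.

Definition is_cotorsor (c : precotorsor) : Prop :=
  [/\ injective c,
      is_under_hom (ct_tau c),
      forall p, (ct_tau c p).2 = p
    & forall mp : M * under_mod c, exists! x : pushout c c, ct_act x = mp].

Record cotorsor : Type := Cotorsor {
  ct_pre :> precotorsor;
  ct_axioms : is_cotorsor ct_pre
}.

Definition is_cotorsor_hom (c d : cotorsor)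
    (h : {linear under_mod c -> under_mod d}) : Prop :=
  is_under_hom h /\
  forall p, ct_tau d (h p) = ((ct_tau c p).1, h (ct_tau c p).2).

Definition cotorsor_iso (c d : cotorsor) : Prop :=
  exists (h : {linear under_mod c -> under_mod d})
         (k : {linear under_mod d -> under_mod c}),
    [/\ is_cotorsor_hom h, is_cotorsor_hom k, cancel h k & cancel k h].

Definition cotorsor_classes : Type :=
  {C : cotorsor -> Prop | exists c, C = cotorsor_iso c}.

Definition cotorsor_class (c : cotorsor) : cotorsor_classes :=
  exist _ (cotorsor_iso c) (ex_intro _ c erefl).

Definition precotorsor_of_ext (e : extension M N) : precotorsor :=
  @Precotorsor (@Under A N (ext_mod e) (val \o ext_ker e))
    (pairing (ext_map e) idfun).

End Cotorsors.

(* Main.v *)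
From HB Require Import structures.
Require Import Defs.
From mathcomp Require Import all_boot all_algebra.
From mathcomp Require Import boolp.

(** The second component of [tau p] is forced to be [p], so an M-cotorsor on
[f : N -> P] amounts to the first component [t : P -> M], and [tau \o f = beta f]
says that [t \o f = 0]. The equation [tau p1 + (0, p2) = (m, p)] reads
[t p1 = m] and [p1 + p2 = p]: it is solvable for all [(m, p)] iff [t] is onto,
and its solution is unique modulo [(f n, - f n)] iff the kernel of [t] is the
image of [f]. Hence M-cotorsors are the same data as extensions of [M] by [N],
with the same morphisms. *)

Set Implicit Arguments.
Unset Strict Implicit.
Unset Printing Implicit Defensive.

Import GRing.Theory.
Local Open Scope ring_scope.

Section EquivalenceClasses.
Context (T : Type) (R : T -> T -> Prop).

(** At [ext_iso] and [cotorsor_iso] this is convertible to [Ext1_class] and [cotorsor_class], so the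
    results on classes apply to both sides. *)
Definition eqv_class (x : T) : {C : T -> Prop | exists x, C = R x} :=
  exist _ (R x) (ex_intro _ x erefl).

Lemma eqv_class_eq (Rsym : forall x y, R x y -> R y x)
    (Rtrans : forall x y z, R x y -> R y z -> R x z) x y :
  R x y -> eqv_class x = eqv_class y.
Proof.
move=> Rxy; apply: eq_exist; apply/funext => z; apply/propext.
by split; apply: Rtrans => //; apply: Rsym.
Qed.

Lemma eqv_class_inj (Rrefl : forall x, R x x) x y :
  eqv_class x = eqv_class y -> R x y.
Proof. by move=> [->]. Qed.

Lemma eqv_class_surj C : exists x, eqv_class x = C.
Proof. by case: C => C [x eC]; exists x; apply: eq_exist. Qed.

End EquivalenceClasses.

(** [F] and [G] need only be mutually inverse up to [R] and [S], as for an equivalence of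
    categories. The induced map applies [F] to a chosen representative; respecting the relations
    makes the choice immaterial. *)
Lemma eqv_classes_bij (T U : Type) (R : T -> T -> Prop) (S : U -> U -> Prop)
    (Rrefl : forall x, R x x) (Rsym : forall x y, R x y -> R y x)
    (Rtrans : forall x y z, R x y -> R y z -> R x z)
    (Srefl : forall x, S x x) (Ssym : forall x y, S x y -> S y x)
    (Strans : forall x y z, S x y -> S y z -> S x z)
    (F : T -> U) (G : U -> T) :
    (forall x y, R x y -> S (F x) (F y)) ->
    (forall u v, S u v -> R (G u) (G v)) ->
    (forall x, R (G (F x)) x) -> (forall u, S (F (G u)) u) ->
  exists Phi : {C : T -> Prop | exists x, C = R x} ->
               {C : U -> Prop | exists u, C = S u},
    (forall x, Phi (eqv_class R x) = eqv_class S (F x)) /\ bijective Phi.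
Proof.
move=> FRS GSR GFK FGK.
have [r rK] := choice (@eqv_class_surj T R).
have [s sK] := choice (@eqv_class_surj U S).
have rP x : R (r (eqv_class R x)) x by apply: eqv_class_inj.
have sP u : S (s (eqv_class S u)) u by apply: eqv_class_inj.
exists (fun C => eqv_class S (F (r C))); split=> [x|].
  by apply: eqv_class_eq => //; apply: FRS.
exists (fun D => eqv_class R (G (s D))) => [C|D].
  rewrite -[RHS]rK; apply: eqv_class_eq => //.
  by apply: Rtrans (GFK _); apply: GSR.
rewrite -[RHS]sK; apply: eqv_class_eq => //.
by apply: Strans (FGK _); apply: FRS.
Qed.

Section ExtensionsAndCotorsors.
Context (A : pzRingType) (M N : lmodType A).
Implicit Types (e : extension M N) (c d : cotorsor M N).

Lemma ext_iso_refl e : ext_iso e e.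
Proof. by exists idfun, idfun; split. Qed.

Lemma ext_iso_sym e1 e2 : ext_iso e1 e2 -> ext_iso e2 e1.
Proof. by move=> [h [k [hh kh hK kK]]]; exists k, h. Qed.

Lemma ext_iso_trans e1 e2 e3 : ext_iso e1 e2 -> ext_iso e2 e3 -> ext_iso e1 e3.
Proof.
move=> [h [k [[h1 h2] [k1 k2] hK kK]]] [h' [k' [[h1' h2'] [k1' k2'] hK' kK']]].
exists (h' \o h), (k \o k'); split;
  [| | exact: can_comp hK' hK | exact: can_comp kK kK'].
- by split=> x /=; rewrite ?h1' ?h1 ?h2 ?h2'.
- by split=> x /=; rewrite ?k1 ?k1' ?k2' ?k2.
Qed.

Lemma cotorsor_iso_refl c : cotorsor_iso c c.
Proof.
exists idfun, idfun; split => //; split=> // p /=; exact: surjective_pairing.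
Qed.

Lemma cotorsor_iso_sym c d : cotorsor_iso c d -> cotorsor_iso d c.
Proof. by move=> [h [k [hh kh hK kK]]]; exists k, h. Qed.

Lemma cotorsor_iso_trans c1 c2 c3 :
  cotorsor_iso c1 c2 -> cotorsor_iso c2 c3 -> cotorsor_iso c1 c3.
Proof.
move=> [h [k [[h1 h2] [k1 k2] hK kK]]] [h' [k' [[h1' h2'] [k1' k2'] hK' kK']]].
exists (h' \o h), (k \o k'); split;
  [| | exact: can_comp hK' hK | exact: can_comp kK kK'].
- by split=> x /=; rewrite ?h1 ?h1' // h2' h2.
- by split=> x /=; rewrite ?k1' ?k1 // k2 k2'.
Qed.

Lemma precotorsor_of_ext_axioms e : is_cotorsor (precotorsor_of_ext e).
Proof.
have tauN : is_under_hom (ct_tau (precotorsor_of_ext e)).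
  by move=> n; congr (_, _); apply/eqP/(valP (ext_ker e n)).
split=> // [|[m p]]; first exact: inj_comp val_inj (bij_inj (ext_ker_bij e)).
have [p1 p1m] := ext_map_surj e m.
(* The second entry is forced by [p1 + p2 = p]. *)
exists (pushout_class (f := precotorsor_of_ext e) p1 (p - p1)); split.
  by rewrite ct_actE //=; congr (_, _); rewrite /= ?addr0 // addrC subrK.
move=> x; rewrite -[x]coker_reprK; case: (coker_repr x) => q1 q2.
rewrite [ct_act _](ct_actE _ _ tauN) => -[/=]; rewrite addr0 => q1m q12.
(* Any other solution [(q1, q2)] has [q1] over [m] too, so [p1 - q1] comes from some [n] in [N]; the
   equal sums make the second entries differ by the opposite. *)
have kP : p1 - q1 \in ker_pred (ext_map e).
  by rewrite unfold_in linearB /= p1m q1m subrr.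
have [g _ gK] := ext_ker_bij e.
apply/coker_classP; exists (g (Ker kP)).
congr (_, _); rewrite /= gK //= -q12 opprB.
by rewrite addrAC addrK.
Qed.

Definition cotorsor_of_ext e : cotorsor M N :=
  Cotorsor (precotorsor_of_ext_axioms e).

Section ExtOfCotorsor.
Context (c : cotorsor M N).

(** The map [t] of the overview, which becomes the surjection of the extension. *)
Definition ct_proj (p : under_mod c) : M := (ct_tau c p).1.

Lemma ct_proj_is_linear : linear ct_proj.
Proof. by move=> a p q; rewrite /ct_proj linearP. Qed.

HB.instance Definition _ :=
  GRing.isLinear.Build A (under_mod c) M *:%R ct_proj ct_proj_is_linear.

Lemma ct_tauE p : ct_tau c p = (ct_proj p, p).
Proof.
by have [_ _ t2 _] := ct_axioms c; rewrite [LHS]surjective_pairing t2.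
Qed.

Lemma ct_proj_surj m : exists p, ct_proj p = m.
Proof.
have [_ _ _ /(_ (m, 0))[x [xm _]]] := ct_axioms c.
move: xm; rewrite /ct_act ct_tauE => -[]; rewrite addr0 => <- _.
by eexists.
Qed.

Lemma ct_proj_under n : (ct_under c n) \in ker_pred ct_proj.
Proof.
have [_ tauN _ _] := ct_axioms c.
by apply/eqP; have /(congr1 fst) := tauN n.
Qed.

(** Both [(p, - p)] and [(0, 0)] solve the equation with right side [0]. By uniqueness they agree in
    the pushout, so [(p, - p)] has the form [(f n, - f n)]. *)
Lemma ct_proj_eq0 p : ct_proj p = 0 -> exists n, ct_under c n = p.
Proof.
move=> p0; have [_ tauN _ /(_ 0)[x [_ xU]]] := ct_axioms c.
have : pushout_class (f := c) p (- p) = pushout_class (f := c) 0 0.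
  rewrite -(xU (pushout_class (f := c) p (- p))).
    by apply: xU; rewrite ct_actE // linear0 add0r.
  by rewrite ct_actE // ct_tauE p0; congr (_, _); rewrite /= ?addr0 ?subrr.
by move=> /coker_classP[n [] /=]; rewrite subr0; exists n.
Qed.

Definition ct_ker (n : N) : ker ct_proj := Ker (ct_proj_under n).

Lemma ct_ker_is_linear : linear ct_ker.
Proof. by move=> a n n'; apply: val_inj; rewrite /= linearP. Qed.

HB.instance Definition _ :=
  GRing.isLinear.Build A N (ker ct_proj) *:%R ct_ker ct_ker_is_linear.

Lemma ct_ker_bij : bijective ct_ker.
Proof.
have [fI _ _ _] := ct_axioms c.
have ct_ker_surj (y : ker ct_proj) : exists n, ct_ker n = y.
  have [n nE] := ct_proj_eq0 (eqP (valP y)).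
  by exists n; apply: val_inj.
(* A right inverse, which injectivity of [f] makes two-sided. *)
have [g gK] := choice ct_ker_surj.
by exists g => // n; apply: fI; have /(congr1 val) := gK (ct_ker n).
Qed.

Definition ext_of_cotorsor : extension M N :=
  Extension (ext_map := ct_proj) ct_proj_surj (ext_ker := ct_ker) ct_ker_bij.

End ExtOfCotorsor.

(** Compatibility with [tau] is automatic in the second component, and in the first it is
    compatibility with the maps to [M]. *)
Lemma cotorsor_of_ext_iso e1 e2 :
  ext_iso e1 e2 -> cotorsor_iso (cotorsor_of_ext e1) (cotorsor_of_ext e2).
Proof.
move=> [h [k [[h1 h2] [k1 k2] hK kK]]]; exists h, k.
by split=> //; split=> // p /=; rewrite /pairing ?h1 ?k1.
Qed.

Lemma ext_of_cotorsor_iso c d :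
  cotorsor_iso c d -> ext_iso (ext_of_cotorsor c) (ext_of_cotorsor d).
Proof.
move=> [h [k [[h1 h2] [k1 k2] hK kK]]]; exists h, k.
by split=> //; split=> // p; rewrite /= /ct_proj ?h2 ?k2.
Qed.

Lemma cotorsor_of_extK e : ext_iso (ext_of_cotorsor (cotorsor_of_ext e)) e.
Proof. by exists idfun, idfun; split. Qed.

(** The module and the map from [N] are unchanged; [tau] is rebuilt from its first component, and
    agrees with the original by [ct_tauE]. *)
Lemma ext_of_cotorsorK c :
  cotorsor_iso (cotorsor_of_ext (ext_of_cotorsor c)) c.
Proof.
by exists idfun, idfun; split=> //; split=> // p; rewrite /= ct_tauE.
Qed.

End ExtensionsAndCotorsors.

Theorem mainTheorem2 (A : pzRingType) (M N : lmodType A) :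
  exists Phi : Ext1 M N -> cotorsor_classes M N,
    (forall e : extension M N, exists c : cotorsor M N,
        ct_pre c = precotorsor_of_ext e /\
        Phi (Ext1_class e) = cotorsor_class c) /\
    bijective Phi.
Proof.
have [Phi [PhiE Phi_bij]] := eqv_classes_bij
  (@ext_iso_refl A M N) (@ext_iso_sym A M N) (@ext_iso_trans A M N)
  (@cotorsor_iso_refl A M N) (@cotorsor_iso_sym A M N)
  (@cotorsor_iso_trans A M N)
  (@cotorsor_of_ext_iso A M N) (@ext_of_cotorsor_iso A M N)
  (@cotorsor_of_extK A M N) (@ext_of_cotorsorK A M N).
exists Phi; split=> // e; exists (cotorsor_of_ext e); split=> //.
exact: PhiE.
Qed.
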